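(* Let $P$ be an affine polynomial in the $n$ variables $\theta_i$, $i=1,\ldots,n$, with $P(\mathbf 0)=1$, and let $\lambda>0$. Suppose that the multivariate gamma distribution $\gamma_{(P,\lambda)}$ associated with $(P,\lambda)$ exists as a probability distribution on $(0,\infty)^n$ (so that $p_i>0$ for all $i$). Then the Laplace copula of $\gamma_{(P,\lambda)}$ is $$C_{L_{\gamma_{(P,\lambda)}}}(\mathbf v)=\Big(\prod_{i=1}^n v_i\Big)\Big[1+\sum_{T\subset[n],\,|T|>1}(-1)^{|T|}P\big(-\tfrac{1}{\mathbf p}\mathbf 1_T\big)\prod_{t\in T}\big(1-v_t^{1/\lambda}\big)\Big]^{-\lambda},\qquad \mathbf v=(v_1,\ldots,v_n)\in(0,1]^n,$$ where $|T|$ is the cardinality of $T$ and the vector $\frac1{\mathbf p}\mathbf 1_T\in\mathbb{R}^n$ is defined by $\big(\frac1{\mathbf p}\mathbf 1_T\big)_i=\frac1{p_i}$ if $i\in T$ and $\big(\frac1{\mathbf p}\mathbf 1_T\big)_i=0$ if $i\notin T$.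
   Context: Write $[n]=\{1,\ldots,n\}$. A polynomial $P$ in $\boldsymbol\theta=(\theta_1,\ldots,\theta_n)$ is affine if $\partial^2P/\partial\theta_j^2=0$ for $j=1,\ldots,n$; thus $P(\boldsymbol\theta)=\sum_{T\subset[n]}p_T\prod_{t\in T}\theta_t$, with $p_\varnothing=P(\mathbf 0)=1$ here, and $p_i:=p_{\{i\}}$. The multivariate gamma distribution $\gamma_{(P,\lambda)}$ associated with $(P,\lambda)$ is the distribution of a random vector $\mathbf X$ whose Laplace transform satisfies $\mathbb{E}\{\exp[-(\theta_1X_1+\cdots+\theta_nX_n)]\}=[P(\boldsymbol\theta)]^{-\lambda}$ for a set of $\boldsymbol\theta$ with non-empty interior. Its marginals are gamma distributions with Laplace transform $(1+p_i\theta_i)^{-\lambda}$. Laplace copula: for a random vector $\mathbf X$ in $(0,\infty)^n$ with Laplace transform $\varphi_{\mathbf X}(\boldsymbol\theta)=\mathbb{E}\{\exp[-(\theta_1X_1+\cdots+\theta_nX_n)]\}$ and marginal Laplace transforms $\varphi_{X_i}(\theta_i)=\mathbb{E}[\exp(-\theta_iX_i)]$ (each a decreasing bijection from $[0,\infty)$ onto $(0,1]$, with inverse $\varphi_{X_i}^{-1}$), the Laplace copula associated to $\mathbf X$ (or to its distribution) is $C_{L_{\mathbf X}}(u_1,\ldots,u_n)=\varphi_{\mathbf X}\big(\varphi_{X_1}^{-1}(u_1),\ldots,\varphi_{X_n}^{-1}(u_n)\big)$. *)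

(* Defs.v *)
From HB Require Import structures.
From mathcomp Require Import all_boot all_order all_algebra.
(* The notations of [mpoly] clash with those of MathComp-Analysis. *)
From mathcomp Require Import -(notations) mpoly.
From mathcomp Require Import all_classical all_reals all_analysis.

Set Implicit Arguments.
Unset Strict Implicit.
Unset Printing Implicit Defensive.

Import Order.TTheory GRing.Theory Num.Theory.
Import numFieldNormedType.Exports.

Local Open Scope classical_set_scope.
Local Open Scope ring_scope.

Section AffinePolynomial.
Variables (R : realType) (n : nat).

(* [mpoly n R] is the type usually written {mpoly R[n]}. *)
Definition affine_poly (P : mpoly n R) : Prop :=
  forall j : 'I_n, mderiv j (mderiv j P) = 0.

Definition poly_at (P : mpoly n R) (theta : 'rV[R]_n) : R :=
  meval (fun i => theta 0 i) P.

(* The coefficient p_i of the monomial theta_i. *)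
Definition lin_coef (P : mpoly n R) (i : 'I_n) : R := mcoeff (mnm1 i) P.

(* The vector (1/p) 1_S. *)
Definition inv_lin_on (P : mpoly n R) (S : {set 'I_n}) : 'rV[R]_n :=
  \row_(i < n) (if i \in S then (lin_coef P i)^-1 else 0).

(* The expression between square brackets in the Laplace copula of the
   multivariate gamma distribution. *)
Definition gamma_copula_base (P : mpoly n R) (lambda : R) (v : 'rV[R]_n) : R :=
  1 + \sum_(S : {set 'I_n} | (1 < #|S|)%N)
        (-1) ^+ #|S| * poly_at P (- inv_lin_on P S)
          * \prod_(t in S) (1 - v 0 t `^ lambda^-1).

End AffinePolynomial.

Section LaplaceCopula.
Context {d : measure_display} {T : measurableType d} {R : realType} {n : nat}.
Variables (Pr : probability T R) (X : 'I_n -> {RV Pr >-> R}).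

(* Laplace transforms take values in \bar R: the expectation of a nonnegative
   random variable is always defined, and may be +oo when some theta_i < 0. *)
Definition laplace (theta : 'rV[R]_n) : \bar R :=
  'E_Pr[fun w => expR (- \sum_(i < n) theta 0 i * X i w)].

Definition marginal_laplace (i : 'I_n) (t : R) : \bar R :=
  'E_Pr[fun w => expR (- (t * X i w))].

(* The inverse of the restriction of the i-th marginal Laplace transform to
   [0, +oo[; the default value 0 is used only outside the range ]0, 1]. *)
Definition marginal_laplace_inv (i : 'I_n) (u : R) : R :=
  'pinv_(fun=> 0) `[0, +oo[ (marginal_laplace i) u%:E.

Definition laplace_copula (u : 'rV[R]_n) : \bar R :=
  laplace (\row_(i < n) marginal_laplace_inv i (u 0 i)).

(* X has the multivariate gamma distribution associated with (P, lambda).  The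
   condition 0 < P(theta) is what makes the real power P(theta)^(-lambda)
   meaningful: the library sets a `^ x = 1 when a < 0 and x is any real. *)
Definition multivariate_gamma (P : mpoly n R) (lambda : R) : Prop :=
  exists2 D : set 'rV[R]_n, interior D !=set0 &
    forall theta, D theta ->
      0 < poly_at P theta /\
      laplace theta = (poly_at P theta `^ (- lambda))%:E.

Definition on_positive_orthant : Prop :=
  Pr [set w | forall i, 0 < X i w] = 1%E.

End LaplaceCopula.

(* Main.v *)
(** The expectation of [expR (- sum_j theta_j X_j)], seen as a function of one
    coordinate t = theta_i, is a weighted Laplace transform of X_i, and since P
    is affine the hypothesis gives it the form (al + be t)^(-lambda) on an
    interval.  All moments of the tilted measure at a point of the interval are
    then those of a gamma law, so expanding the exponential and using the
    binomial series shows that the formula persists wherever the transform is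
    finite, with al + be t > 0.  Moving one coordinate at a time, first upwards
    from a box inside the given open set and then downwards, carries
    E[exp(-<theta, X>)] = P(theta)^(-lambda) to the whole nonnegative orthant.
    The marginals can then be inverted explicitly, and the copula formula
    follows from the multiaffine identity, with w_i = v_i^(1/lambda),
      prod_i w_i * P((1/w_i - 1) / p_i) = sum_S (-1)^|S| P(-1_S/p) prod_S (1 - w_t),
    whose terms with |S| = 1 vanish. *)
Require Import Defs.
From mathcomp Require Import all_boot all_order all_algebra.
From mathcomp Require Import -(notations) mpoly.
From mathcomp Require Import all_classical all_reals all_analysis measurable_realfun.
From mathcomp Require Import zify ring lra.
Import Order.TTheory GRing.Theory Num.Theory.
Import numFieldNormedType.Exports.
Local Open Scope classical_set_scope.
Local Open Scope ring_scope.

Set Implicit Arguments.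
Unset Strict Implicit.
Unset Printing Implicit Defensive.

(** * The binomial series *)

Definition rising (R : realType) (a : R) (k : nat) : R :=
  \prod_(i < k) (a + i%:R).

Lemma rising0 (R : realType) (a : R) : rising a 0 = 1.
Proof. by rewrite /rising big_ord0. Qed.

Lemma risingSr (R : realType) (a : R) k :
  rising a k.+1 = rising a k * (a + k%:R).
Proof. by rewrite /rising big_ord_recr. Qed.

Lemma risingS (R : realType) (a : R) k : rising a k.+1 = a * rising (a + 1) k.
Proof.
rewrite /rising big_ord_recl /= addr0; congr (_ * _).
by apply: eq_bigr => i _; rewrite /bump /= add1n -natr1; ring.
Qed.

Lemma risingD (R : realType) (a : R) k j :
  rising a (k + j) = rising a k * rising (a + k%:R) j.
Proof.
elim: j => [|j IH]; first by rewrite addn0 rising0 mulr1.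
by rewrite addnS !risingSr IH natrD; ring.
Qed.

Lemma rising_gt0 (R : realType) (a : R) k : 0 < a -> 0 < rising a k.
Proof. by move=> a0; apply: prodr_gt0 => i _; rewrite ltr_wpDr. Qed.

(** The coefficient of [x^k] in [(1 - x)^(-a)]; with this sign convention it is nonnegative for
    [a > 0]. *)
Definition binom_coeff (R : realType) (a : R) (k : nat) : R :=
  rising a k / k`!%:R.

Lemma binom_coeff_ge0 (R : realType) (a : R) k :
  0 < a -> 0 <= binom_coeff a k.
Proof. by move=> a0; rewrite divr_ge0// ltW// rising_gt0. Qed.

Lemma binom_coeffS (R : realType) (a : R) k :
  k.+1%:R * binom_coeff a k.+1 = (a + k%:R) * binom_coeff a k.
Proof.
rewrite /binom_coeff risingSr factS natrM; field.
by rewrite nat1r !pnatr_eq0 -lt0n fact_gt0.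
Qed.

(** Termwise form of the rule that the derivative of [(1 - x)^(-a)] is [a (1 - x)^(-(a + 1))]. *)
Lemma pseries_diffs_binom_coeff (R : realType) (a : R) :
  pseries_diffs (binom_coeff a) = a *: (binom_coeff (a + 1) : R^nat).
Proof.
apply/funext => k.
change (k.+1%:R * binom_coeff a k.+1 = a * binom_coeff (a + 1) k).
rewrite /binom_coeff risingS factS natrM; field.
by rewrite nat1r !pnatr_eq0 -lt0n fact_gt0.
Qed.

(** Ratio test: for [|x| < r < q < 1], successive terms at [r] have ratio [r (a + k) / (k + 1)],
    which is eventually at most [q], so a geometric series dominates. *)
Lemma is_cvg_binom_series (R : realType) (a x : R) :
  0 < a -> `|x| < 1 -> cvgn (pseries (binom_coeff a) x).
Proof.
move=> a0 x1.
have [r /andP[xr r1]] : exists r : R, `|x| < r < 1.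
  by exists ((`|x| + 1) / 2); rewrite !midf_lt.
have r0 : 0 < r by exact: le_lt_trans xr.
have rN : r = `|r| by rewrite gtr0_norm.
apply: (@is_cvg_pseries_inside _ _ r); last by rewrite -rN.
have [q /andP[rq q1]] : exists q : R, r < q < 1.
  by exists ((r + 1) / 2); rewrite !midf_lt.
have q0 : 0 < q by exact: lt_trans rq.
pose u k := binom_coeff a k * r ^+ k.
have u0 k : 0 <= u k by rewrite mulr_ge0 ?binom_coeff_ge0// exprn_ge0// ltW.
have uS k : u k.+1 = u k * (r * (a + k%:R) / k.+1%:R).
  have -> : u k.+1 = k.+1%:R * binom_coeff a k.+1 * r ^+ k.+1 / k.+1%:R.
    by rewrite /u; field; rewrite nat1r pnatr_eq0.
  by rewrite binom_coeffS /u exprS; ring.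
(* [r (a + k) <= q (k + 1)] holds as soon as [r a <= (q - r) k]. *)
have [J HJ] : exists J : nat, r * a / (q - r) < J%:R.
  by exists (Num.truncn (r * a / (q - r))).+1; exact: truncnS_gt.
have step k : (J <= k)%N -> u k.+1 <= q * u k.
  move=> Jk; rewrite uS mulrC ler_wpM2r// ler_pdivrMr ?ltr0n//.
  have : r * a / (q - r) <= k%:R by apply: (le_trans (ltW HJ)); rewrite ler_nat.
  rewrite ler_pdivrMr ?subr_gt0// -natr1 => H.
  by nra.
(* The constant contains [u i / q ^+ i] for every [i <= J], so the bound holds at these indices;
   [step] then propagates it. *)
apply: (@series_le_cvg _ u (geometric (\sum_(i < J.+1) u i / q ^+ i) q)) => //.
- by move=> k; rewrite /geometric /= mulr_ge0 ?exprn_ge0 ?(ltW q0)// sumr_ge0// =>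
    i _; rewrite divr_ge0// exprn_ge0// ltW.
- move=> k; rewrite /geometric/=.
  have small i : (i < J.+1)%N ->
      u i <= (\sum_(i < J.+1) u i / q ^+ i) * q ^+ i.
    move=> iJ; rewrite -ler_pdivrMr ?exprn_gt0// (bigD1 (Ordinal iJ)) //= lerDl.
    by rewrite sumr_ge0// => j _; rewrite divr_ge0// exprn_ge0// ltW.
  elim: k => [|k IH]; first exact: small.
  have [kJ|Jk] := ltnP k.+1 J.+1; first exact: small.
  by rewrite (le_trans (step _ Jk))// exprS [leRHS]mulrCA ler_wpM2l// ltW.
- by apply: is_cvg_geometric_series; rewrite gtr0_norm.
Qed.

Lemma pseriesZ (R : realType) (b : R) (c : R^nat) (y : R) :
  pseries (b *: c) y = b *: (pseries c y : R^nat).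
Proof.
apply/funext => n; rewrite /pseries /series /= [RHS]scaler_sumr.
by apply: eq_bigr => i _; rewrite /= -scalerAl.
Qed.

(** Termwise differentiation requires convergence of the series and of its first two formal
    derivatives at some [r > |x|]; up to constants these are the binomial series of parameters [a],
    [a + 1] and [a + 2]. *)
Lemma is_derive_binom_series (R : realType) (a x : R) :
  0 < a -> `|x| < 1 ->
  is_derive x 1 (fun y => limn (pseries (binom_coeff a) y))
    (a * limn (pseries (binom_coeff (a + 1)) x)).
Proof.
move=> a0 x1.
have [r /andP[xr r1]] : exists r : R, `|x| < r < 1.
  by exists ((`|x| + 1) / 2); rewrite !midf_lt.
have rN : r = `|r| by rewrite gtr0_norm //; exact: le_lt_trans xr.
have a1 : 0 < a + 1 by rewrite addr_gt0.
have cB b y : 0 < b -> `|y| < 1 -> cvgn (pseries (binom_coeff b) y).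
  exact: is_cvg_binom_series.
have diffsZ b (c : R^nat) : pseries_diffs (b *: c) = b *: pseries_diffs c.
  by apply/funext => k; rewrite /pseries_diffs/= -scalerAr.
have -> : a * limn (pseries (binom_coeff (a + 1)) x) =
    limn (pseries (pseries_diffs (binom_coeff a)) x).
  rewrite pseries_diffs_binom_coeff pseriesZ; apply/esym/cvg_lim => //.
  by apply: cvgZl_tmp; apply: cB.
apply: (@pseries_snd_diffs _ _ r); rewrite -?rN //.
- by apply: cB; rewrite // -rN.
- rewrite pseries_diffs_binom_coeff pseriesZ; apply: is_cvgZl_tmp.
  by apply: cB; rewrite // -rN.
- rewrite pseries_diffs_binom_coeff diffsZ pseries_diffs_binom_coeff.
  rewrite !pseriesZ; do 2!apply: is_cvgZl_tmp.
  by apply: cB; rewrite ?addr_gt0// -rN.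
Qed.

(** Pascal's rule, summed. Combined with the derivative it yields the differential equation
    [(1 - x) f' = a f]. *)
Lemma binom_seriesS (R : realType) (a x : R) : 0 < a -> `|x| < 1 ->
  (1 - x) * limn (pseries (binom_coeff (a + 1)) x) =
  limn (pseries (binom_coeff a) x).
Proof.
move=> a0 x1.
have c1 := is_cvg_binom_series (addr_gt0 a0 ltr01) x1.
have c0 := is_cvg_binom_series a0 x1.
apply/esym/cvg_lim => //.
(* Multiplication by [x] shifts partial sums by one index, with value 0 at index 0, so the identity
   is exact for partial sums. *)
have -> : pseries (binom_coeff a) x = pseries (binom_coeff (a + 1)) x -
    (fun n => x * (if n is m.+1 then pseries (binom_coeff (a + 1)) x m else 0)).
  apply/funext => -[|n].
    by rewrite -[RHS]/(_ - x * 0) mulr0 subr0 /pseries /series/= !big_geq.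
  rewrite -[RHS]/(_ - x * pseries (binom_coeff (a + 1)) x n) /pseries /series/=.
  rewrite big_nat_recl// [in RHS]big_nat_recl// mulr_sumr -addrA -sumrB.
  congr (_ + _).
    by rewrite /binom_coeff !rising0.
  apply: eq_bigr => i _.
  suff -> : binom_coeff a i.+1 = binom_coeff (a + 1) i.+1 - binom_coeff (a + 1) i.
    by rewrite exprS; ring.
  rewrite /binom_coeff risingS risingSr factS natrM -natr1; field.
  by rewrite natr1 !pnatr_eq0 -lt0n fact_gt0.
rewrite mulrBl mul1r; apply: cvgB => //; apply: cvgMl_tmp.
by rewrite -cvg_shiftS.
Qed.

(** The product of the sum with [(1 - y)^a] has zero derivative on []-1, 1[] and equals 1 at 0. *)
Lemma binom_series (R : realType) (a x : R) : 0 < a -> `|x| < 1 ->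
  pseries (binom_coeff a) x @ \oo --> (1 - x) `^ (- a).
Proof.
move=> a0 x1.
have c0 := is_cvg_binom_series a0 x1.
pose f (y : R) := limn (pseries (binom_coeff a) y) * (1 - y) `^ a.
have df (y : R) : `|y| < 1 -> is_derive y (1 : R) f (0 : R).
  move=> y1; have y0 : 0 < 1 - y by rewrite subr_gt0 (le_lt_trans (ler_norm y)).
  have d1 := is_derive_binom_series a0 y1.
  have d2 : is_derive y (1 : R) ((fun z : R => z `^ a) \o (fun z : R => 1 - z))
      (a * (1 - y) `^ (a - 1) * (0 - 1)).
    by apply: is_derive1_comp; exact: is_derive1_powR.
  apply: (is_derive_eq (is_deriveM d1 d2)); rewrite /GRing.scale/=.
  rewrite -(binom_seriesS a0 y1) -(mulr_powRB1 (ltW y0) a0).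
  ring.
have cstf (y z : R) : `|y| < 1 -> `|z| < 1 -> y <= z -> f y = f z.
  move=> y1 z1 yz.
  have I t : t \in `[y, z] -> is_derive t 1 f 0.
    rewrite in_itv/= => /andP[yt tz]; apply: df.
    by move: y1 z1; rewrite !ltr_norml; lra.
  have I' t : t \in `]y, z[%R -> is_derive t (1 : R) f ((fun=> 0) t).
    by move=> /subset_itv_oo_cc; exact: I.
  have C : {within `[y, z], continuous f}.
    by apply: derivable_within_continuous => t /I[].
  have [c _] := MVT_segment yz I' C.
  by rewrite mul0r => /subr0_eq.
have f0 : f 0 = 1.
  rewrite /f subr0 powR1 mulr1; apply/cvg_lim => //.
  rewrite -cvg_shiftS; apply: cvg_near_cst; apply: nearW => n.
  rewrite /pseries /series/= big_nat_recl// big1 ?addr0.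
    by rewrite expr0 mulr1 /binom_coeff rising0 divr1.
  by move=> i _; rewrite expr0n mulr0.
have f1 : f x = 1.
  rewrite -f0; have [x0|/ltW x0] := leP 0 x; last by apply: cstf; rewrite ?normr0.
  by apply/esym/cstf; rewrite ?normr0.
have x0 : (1 - x) `^ a != 0.
  by rewrite gt_eqF// powR_gt0// subr_gt0 (le_lt_trans (ler_norm x)).
suff -> : (1 - x) `^ (- a) = limn (pseries (binom_coeff a) x) by [].
by rewrite -[LHS]mul1r -{1}f1 powRN mulfK.
Qed.

(** * Uniqueness for weighted Laplace transforms *)

(** [B] stands for one coordinate of the random vector. The weight [Z] absorbs everything else: the
    other coordinates, powers of [B], exponential tilts. *)
Definition weighted_laplace (d : measure_display) (T : measurableType d)
    (R : realType) (mu : {measure set T -> \bar R}) (B Z : T -> R) (t : R) :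
    \bar R :=
  (\int[mu]_w (Z w * expR (- (t * B w)))%:E)%E.

Lemma measurable_weighted_exp (d : measure_display) (T : measurableType d)
    (R : realType) (B Z : T -> R) (t : R) :
  measurable_fun setT B -> measurable_fun setT Z ->
  measurable_fun setT ((fun w => (Z w * expR (- (t * B w)))%:E) : T -> \bar R).
Proof.
move=> mB mZ; apply/measurable_EFinP/measurable_funM => //.
by apply: measurableT_comp => //; apply: measurableT_comp => //;
  exact: measurable_funM.
Qed.

Lemma weighted_laplace_nincr (d : measure_display) (T : measurableType d)
    (R : realType) (mu : {measure set T -> \bar R}) (B Z : T -> R) (s t : R) :
  measurable_fun setT B -> measurable_fun setT Z ->
  (forall w, 0 <= B w) -> (forall w, 0 <= Z w) -> s <= t ->
  (weighted_laplace mu B Z t <= weighted_laplace mu B Z s)%E.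
Proof.
move=> mB mZ B0 Z0 st; apply: ge0_le_integral => //.
- by move=> w _; rewrite lee_fin mulr_ge0// expR_ge0.
- exact: measurable_weighted_exp.
- exact: measurable_weighted_exp.
- by move=> w _; rewrite lee_fin ler_wpM2l// ler_expR lerN2 ler_wpM2r.
Qed.

(** The conclusion has the form of the hypothesis, with [Z \* B], [c * l] and [l + 1] for [Z], [c]
    and [l], so the lemma can be iterated. *)
Lemma weighted_laplace_derive (d : measure_display) (T : measurableType d)
    (R : realType) (mu : {measure set T -> \bar R}) (B Z : T -> R)
    (l c a b : R) :
  measurable_fun setT B -> measurable_fun setT Z ->
  (forall w, 0 <= B w) -> (forall w, 0 <= Z w) -> 0 <= a ->
  {in `]a, b[, forall t, weighted_laplace mu B Z t = (c * t `^ (- l))%:E} ->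
  {in `]a, b[, forall t, weighted_laplace mu B (Z \* B)%R t =
     (c * l * t `^ (- (l + 1)))%:E}.
Proof.
move=> mB mZ B0 Z0 a0 LE t tab.
have mZB : measurable_fun setT (Z \* B) by exact: measurable_funM.
have e0 (W : T -> R) s w : (forall w, 0 <= W w) ->
    (0 <= (W w * expR (- (s * B w)))%:E)%E.
  by move=> W0; rewrite lee_fin mulr_ge0// expR_ge0.
have ZB0 w : 0 <= (Z \* B)%R w by rewrite mulr_ge0.
have G0 : (0 <= weighted_laplace mu B (Z \* B)%R t)%E.
  by apply: integral_ge0 => w _; exact: e0.
have sumE k s : 0 <= k -> (weighted_laplace mu B Z s +
      k%:E * weighted_laplace mu B (Z \* B)%R t)%E =
    (\int[mu]_w (Z w * expR (- (s * B w)) +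
      k * (Z w * B w * expR (- (t * B w))))%R%:E)%E.
  move=> k0; rewrite /weighted_laplace -ge0_integralZl_EFin//=; last 2 first.
  - by move=> w _; exact: (e0 (Z \* B)).
  - exact: (measurable_weighted_exp _ mB mZB).
  rewrite -ge0_integralD//=.
  - by move=> w _; exact: e0.
  - exact: measurable_weighted_exp.
  - by move=> w _; rewrite mule_ge0//; exact: (e0 (Z \* B)).
  - by apply: measurable_funeM; exact: (measurable_weighted_exp _ mB mZB).
(* Integrating the tangent line inequality for the convex [x |-> e^(-x B)] shows
   that [x |-> c x^(-l) + x g] is minimal at [t], where [g] is the transform of
   [Z B] at [t]; hence [g] is minus the derivative of [c x^(-l)]. *)
have low x : x <= t -> (weighted_laplace mu B Z t +
    (t - x)%:E * weighted_laplace mu B (Z \* B)%R t <= weighted_laplace mu B Z x)%E.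
  move=> xt; rewrite sumE ?subr_ge0//; apply: ge0_le_integral => //.
  - move=> w _; rewrite lee_fin addr_ge0 ?mulr_ge0 ?expR_ge0//.
    by rewrite subr_ge0.
  - apply/measurable_EFinP/measurable_funD.
      by apply/measurable_EFinP; exact: measurable_weighted_exp.
    apply: measurable_funM => //.
    by apply/measurable_EFinP; exact: (measurable_weighted_exp _ mB mZB).
  - exact: measurable_weighted_exp.
  - move=> w _; rewrite lee_fin.
    have -> : - (x * B w) = (t - x) * B w + - (t * B w) by ring.
    rewrite expRD; set u := expR (- (t * B w)).
    have u0 : 0 <= u by exact: expR_ge0.
    have -> : Z w * u + (t - x) * (Z w * B w * u) =
      Z w * ((1 + (t - x) * B w) * u) by ring.
    by rewrite ler_wpM2l// ler_wpM2r// expR_ge1Dx.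
have high x : t <= x -> (weighted_laplace mu B Z t <=
    weighted_laplace mu B Z x + (x - t)%:E * weighted_laplace mu B (Z \* B)%R t)%E.
  move=> xt; rewrite sumE ?subr_ge0//; apply: ge0_le_integral => //.
  - by move=> w _; exact: e0.
  - exact: measurable_weighted_exp.
  - apply/measurable_EFinP/measurable_funD.
      by apply/measurable_EFinP; exact: measurable_weighted_exp.
    apply: measurable_funM => //.
    by apply/measurable_EFinP; exact: (measurable_weighted_exp _ mB mZB).
  - move=> w _; rewrite lee_fin.
    have -> : - (x * B w) = (t - x) * B w + - (t * B w) by ring.
    rewrite expRD; set u := expR (- (t * B w)).
    have u0 : 0 <= u by exact: expR_ge0.
    rewrite -lerBlDr.
    have -> : Z w * u - (x - t) * (Z w * B w * u) =
      Z w * ((1 + (t - x) * B w) * u) by ring.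
    by rewrite ler_wpM2l// ler_wpM2r// expR_ge1Dx.
have [at_ tb] : a < t /\ t < b by move: tab; rewrite in_itv/= => /andP.
(* An infinite value would make the left side of [low] infinite at any [x] in []a, t[], where the
   right side is finite. *)
have Gfin : weighted_laplace mu B (Z \* B)%R t \is a fin_num.
  have [x /andP[ax xt]] : exists x, a < x < t.
    by exists ((a + t) / 2); rewrite !midf_lt.
  have := low x (ltW xt); rewrite !LE//; last first.
    by rewrite in_itv/= ax (lt_trans xt).
  move: G0; case: (weighted_laplace mu B (Z \* B)%R t) => //= _.
  by rewrite mulry gtr0_sg ?subr_gt0// mul1e.
move: low high; rewrite -(fineK Gfin); set g := fine _ => low high.
congr EFin.
pose f (x : R) := c * x `^ (- l) + x * g.
have df x : x \in `]a, b[ ->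
    is_derive x (1 : R) f (c * (- l * x `^ (- l - 1)) + g).
  rewrite in_itv/= => /andP[ax _].
  have x0 : 0 < x by exact: le_lt_trans ax.
  have d1 := is_derive1_powR (- l) x0.
  have := is_deriveD (is_deriveZ c d1) (is_deriveZ g (is_derive_id x (1 : R))).
  rewrite /GRing.scale/= mulr1.
  set F := (F in is_derive _ _ F _) => HF.
  have -> : f = F by apply/funext => y; rewrite /f /F [y * g]mulrC.
  exact: HF.
have f0 : is_derive t (1 : R) f 0.
  apply: (@derive1_at_min _ f a b t) => //.
  - by rewrite ltW// (lt_trans at_).
  - by move=> x /df[].
  - move=> x xab; rewrite /f; have [xt|tx] := leP x t.
      have := low x xt; rewrite !LE// -EFinM -EFinD lee_fin; lra.
    have := high x (ltW tx); rewrite !LE// -EFinM -EFinD lee_fin; lra.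
have [_ e1] := f0; have [_ e2] := df _ tab.
move: e1; rewrite e2 opprD; lra.
Qed.

Lemma weighted_laplace_moments (d : measure_display) (T : measurableType d)
    (R : realType) (mu : {measure set T -> \bar R}) (B Z : T -> R)
    (l c a b : R) (k : nat) :
  measurable_fun setT B -> measurable_fun setT Z ->
  (forall w, 0 <= B w) -> (forall w, 0 <= Z w) -> 0 <= a ->
  {in `]a, b[, forall t, weighted_laplace mu B Z t = (c * t `^ (- l))%:E} ->
  {in `]a, b[, forall t, weighted_laplace mu B (fun w => Z w * B w ^+ k) t =
     (c * rising l k * t `^ (- (l + k%:R)))%:E}.
Proof.
move=> mB mZ B0 Z0 a0; elim: k Z mZ Z0 l c => [|k IH] Z mZ Z0 l c LE t tab.
  under eq_fun do rewrite expr0 mulr1.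
  by rewrite LE// rising0 mulr1 addr0.
have mZB : measurable_fun setT (Z \* B) by exact: measurable_funM.
have ZB0 w : 0 <= (Z \* B)%R w by rewrite mulr_ge0.
have := IH _ mZB ZB0 _ _ (weighted_laplace_derive mB mZ B0 Z0 a0 LE) _ tab.
under eq_fun do rewrite /= -mulrA -exprS.
by move=> ->; rewrite risingS -natr1 [k%:R + 1]addrC !addrA !mulrA.
Qed.

(** Expanding [e^(s B)] and integrating term by term against [Z e^(-t B)] turns the assumed moments
    into the binomial series in [s / t], which converges for [|s| < t]. *)
Lemma weighted_laplace_expand (d : measure_display) (T : measurableType d)
    (R : realType) (mu : {measure set T -> \bar R}) (B Z : T -> R)
    (l c t s : R) :
  measurable_fun setT B -> measurable_fun setT Z ->
  (forall w, 0 <= B w) -> (forall w, 0 <= Z w) -> 0 < l -> 0 < t ->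
  (forall k, weighted_laplace mu B (fun w => Z w * B w ^+ k) t =
     (c * rising l k * t `^ (- (l + k%:R)))%:E) ->
  `|s| < t -> weighted_laplace mu B Z (t - s) = (c * (t - s) `^ (- l))%:E.
Proof.
move=> mB mZ B0 Z0 l0 t0 mom st.
pose m k w := Z w * B w ^+ k * expR (- (t * B w)).
have mZB k : measurable_fun setT (fun w => Z w * B w ^+ k).
  by apply: measurable_funM => //; exact: measurable_funX.
have mm k : measurable_fun setT (m k).
  by apply/measurable_EFinP; exact: (measurable_weighted_exp _ mB (mZB k)).
have m0 k w : 0 <= m k w by rewrite /m !mulr_ge0 ?exprn_ge0 ?expR_ge0.
have im k : mu.-integrable setT (EFin \o m k).
  apply/integrableP; split; first exact/measurable_EFinP.
  under eq_integral => w _ do rewrite /= ger0_norm//.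
  by move: (mom k); rewrite /weighted_laplace => ->; rewrite ltry.
pose P y n w := \sum_(0 <= k < n) exp_coeff y k * m k w.
have mP y n : measurable_fun setT (P y n).
  by apply: measurable_sum => k; exact: measurable_funM.
have PE y n w : P y n w =
    Z w * expR (- (t * B w)) * series (exp_coeff (y * B w)) n.
  rewrite /P /series/= mulr_sumr; apply: eq_bigr => k _.
  by rewrite /exp_coeff/= /m exprMn; ring.
have cPR y w : P y n w @[n --> \oo] --> Z w * expR (- ((t - y) * B w)).
  have -> : - ((t - y) * B w) = - (t * B w) + y * B w by ring.
  rewrite expRD mulrA; under eq_fun do rewrite /= PE.
  by apply: cvgMl_tmp; exact: is_cvg_series_exp_coeff.
have cP y w : (P y n w)%:E @[n --> \oo] --> (Z w * expR (- ((t - y) * B w)))%:E.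
  by apply: cvg_EFin; [exact: nearW|exact: cPR].
have ndP w n1 n2 : (n1 <= n2)%N -> P `|s| n1 w <= P `|s| n2 w.
  move=> n12; rewrite /P (big_cat_nat (leq0n n1) n12)//= lerDl.
  by rewrite sumr_ge0// => k _; rewrite mulr_ge0// exp_coeff_ge0.
have IP y n : (\int[mu]_w (P y n w)%:E)%E =
    (c * t `^ (- l) * pseries (binom_coeff l) (y / t) n)%:E.
  rewrite /P; under eq_integral => w _.
    rewrite -sumEFin; under eq_bigr do rewrite EFinM; over.
  rewrite integral_sum//; last by move=> k; apply: (integrableZl _ _ (im k)).
  rewrite /pseries /series/= mulr_sumr -sumEFin; apply: eq_bigr => k _.
  rewrite (integralZl measurableT (im k)) [X in (_ * X)%E]mom -EFinM.
  congr EFin; rewrite /exp_coeff /binom_coeff/= opprD powRD; last first.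
    by rewrite (gt_eqF t0) implybT.
  by rewrite powR_invn ?(ltW t0)// exprMn exprVn; ring.
have yt y : `|y| < t -> `|y / t| < 1.
  by move=> H; rewrite normrM normfV (gtr0_norm t0) ltr_pdivrMr ?mul1r.
have cIP y : `|y| < t ->
    (\int[mu]_w (P y n w)%:E)%E @[n --> \oo] --> (c * (t - y) `^ (- l))%:E.
  move=> H; under eq_fun do rewrite IP.
  apply: cvg_EFin; first exact: nearW.
  have y0 : 0 < 1 - y / t.
    by rewrite subr_gt0 (le_lt_trans (ler_norm _))// yt.
  have -> : t - y = t * (1 - y / t).
    by field; rewrite gt_eqF.
  rewrite powRM ?(ltW t0) ?(ltW y0)// mulrA.
  by apply: cvgMl_tmp; exact: binom_series (yt _ H).
(* For [|s|] the partial sums increase, so monotone convergence applies; the limit is then an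
   integrable bound for the partial sums at [s]. *)
have aE : (\int[mu]_w (Z w * expR (- ((t - `|s|) * B w)))%:E)%E =
    (c * (t - `|s|) `^ (- l))%:E.
  have s1 : `| `|s| | < t by rewrite normr_id.
  rewrite -(cvg_lim _ (cIP _ s1))// -monotone_convergence//.
  - by apply: eq_integral => w _; apply/esym/cvg_lim => //; exact: cP.
  - by move=> n; apply/measurable_EFinP.
  - move=> n w _; rewrite lee_fin sumr_ge0// => k _.
    by rewrite mulr_ge0// exp_coeff_ge0.
  - by move=> w _ n1 n2 n12; rewrite lee_fin ndP.
have [|||||_ _ cvgI] := @dominated_convergence _ _ _ mu setT measurableT
  (fun n w => (P s n w)%:E) (fun w => (Z w * expR (- ((t - s) * B w)))%:E)
  (fun w => (Z w * expR (- ((t - `|s|) * B w)))%:E).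
- by move=> n; apply/measurable_EFinP.
- exact: measurable_weighted_exp.
- by apply: aeW => w _; exact: cP.
- apply/integrableP; split; first exact: measurable_weighted_exp.
  under eq_integral => w _ do
    rewrite /= ger0_norm ?mulr_ge0 ?expR_ge0//.
  by rewrite aE ltry.
- apply: aeW => w n _; rewrite abse_EFin lee_fin.
  have Ple : `|P s n w| <= P `|s| n w.
    rewrite /P (le_trans (ler_norm_sum _ _ _))// ler_sum// => k _.
    by rewrite normrM (ger0_norm (m0 k w)) /exp_coeff/= normrM normrX
      [ `|_^-1|]ger0_norm.
  rewrite (le_trans Ple)// -(cvg_lim _ (cPR `|s| w))//.
  by apply: nondecreasing_cvgn_le; [exact: ndP|exact: cvgP (cPR _ _)].
rewrite /weighted_laplace; move/(cvg_lim _) : cvgI => /= <- //.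
by apply/cvg_lim => //; exact: cIP.
Qed.

(** The moments at an interior point [u] give the formula at distance less than [u]; re-expanding at
    new points then reaches the whole half-line. *)
Lemma weighted_laplace_gamma (d : measure_display) (T : measurableType d)
    (R : realType) (mu : {measure set T -> \bar R}) (B Z : T -> R)
    (l c a b t : R) :
  measurable_fun setT B -> measurable_fun setT Z ->
  (forall w, 0 <= B w) -> (forall w, 0 <= Z w) -> 0 < l -> 0 <= a -> a < b ->
  {in `]a, b[, forall t, weighted_laplace mu B Z t = (c * t `^ (- l))%:E} ->
  0 < t -> weighted_laplace mu B Z t = (c * t `^ (- l))%:E.
Proof.
move=> mB mZ B0 Z0 l0 a0 ab LE.
(* All moments are propagated, not only the transform, since they are what an expansion at the next
   point needs. *)
pose K (t : R) := forall k, weighted_laplace mu B (fun w => Z w * B w ^+ k) t =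
  (c * rising l k * t `^ (- (l + k%:R)))%:E.
(* [Z B^k] is itself a weight, of exponent [l + k]; [risingD] identifies its moments at [u]. *)
have stepK (u s : R) : 0 < u -> K u -> `|s| < u -> K (u - s).
  move=> u0 Ku su k; apply: weighted_laplace_expand su => //.
  - by apply: measurable_funM => //; exact: measurable_funX.
  - by move=> w; rewrite mulr_ge0// exprn_ge0.
  - by rewrite ltr_wpDr.
  - move=> j; have := Ku (k + j)%N.
    rewrite risingD natrD addrA !mulrA => <-; congr weighted_laplace.
    by apply/funext => w; rewrite exprD mulrA.
pose u := (a + b) / 2.
have [au ub] : a < u /\ u < b by rewrite !midf_lt.
have u0 : 0 < u by exact: le_lt_trans au.
have Ku : K u.
  move=> k; apply: (weighted_laplace_moments k mB mZ B0 Z0 a0 LE).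
  by rewrite in_itv/= au ub.
have Kn n : forall t, 0 < t -> t <= u + n%:R * (u / 2) -> K t.
  elim: n => [|n IH] s s0 su.
    have -> : s = u - (u - s) by ring.
    apply: stepK => //; move: su; rewrite mul0r addr0 => su.
    by rewrite ger0_norm; lra.
  have [|us] := leP s (u + n%:R * (u / 2)); first exact: IH.
  have n0 : 0 <= n%:R * (u / 2) by rewrite mulr_ge0//; lra.
  (* The new centre exceeds [u / 2], so a step of length [u / 2] stays within the radius of
     expansion. *)
  have -> : s = (s - u / 2) - - (u / 2) by ring.
  apply: stepK; first lra.
    by apply: IH; [lra|move: su; rewrite -natr1; lra].
  by rewrite normrN ger0_norm; lra.
move=> t0; have [n tn] : exists n : nat, t / (u / 2) < n%:R.
  by exists (Num.truncn (t / (u / 2))).+1; exact: truncnS_gt.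
have := Kn n t t0 _ 0%N; rewrite rising0 mulr1 addr0.
under eq_fun do rewrite expr0 mulr1.
apply; move: tn; rewrite ltr_pdivrMr; lra.
Qed.

(** By monotonicity, a finite value at some [t <= 0] would bound [c s^(-l)] for all [s > 0], but
    this blows up at 0. *)
Lemma weighted_laplace_gamma_pos (d : measure_display) (T : measurableType d)
    (R : realType) (mu : {measure set T -> \bar R}) (B Z : T -> R)
    (l c t : R) :
  measurable_fun setT B -> measurable_fun setT Z ->
  (forall w, 0 <= B w) -> (forall w, 0 <= Z w) -> 0 < l -> 0 < c ->
  (forall s, 0 < s -> weighted_laplace mu B Z s = (c * s `^ (- l))%:E) ->
  (weighted_laplace mu B Z t < +oo)%E -> 0 < t.
Proof.
move=> mB mZ B0 Z0 l0 c0 LE fin; rewrite ltNge; apply/negP => t0.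
have W0 : (0 <= weighted_laplace mu B Z t)%E.
  by apply: integral_ge0 => w _; rewrite lee_fin mulr_ge0// expR_ge0.
have Wfin : weighted_laplace mu B Z t \is a fin_num by rewrite ge0_fin_numE.
move: W0 LE; rewrite -(fineK Wfin) lee_fin; set M := fine _ => M0 LE.
pose e := ((M + 1) / c) `^ (- l^-1).
have Mc : 0 < (M + 1) / c by rewrite divr_gt0// ltr_wpDl.
have e0 : 0 < e by exact: powR_gt0.
have := weighted_laplace_nincr mu mB mZ B0 Z0 (le_trans t0 (ltW e0)).
rewrite LE// -(fineK Wfin) lee_fin -/M /e -powRrM.
rewrite mulrNN mulVf ?gt_eqF// powRr1 ?(ltW Mc)// mulrC divfK ?gt_eqF//.
by rewrite leNgt ltrDl ltr01.
Qed.

(** Since [al + be t = be (t + tau)] with [tau = al / be], tilting the weight by [e^(tau B)]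
    translates the variable and reduces to a pure power. *)
Lemma weighted_laplace_affine (d : measure_display) (T : measurableType d)
    (R : realType) (mu : {measure set T -> \bar R}) (B Z : T -> R)
    (l al be a b t : R) :
  measurable_fun setT B -> measurable_fun setT Z ->
  (forall w, 0 <= B w) -> (forall w, 0 <= Z w) -> 0 < l -> 0 < be -> a < b ->
  {in `]a, b[, forall t, 0 < al + be * t /\
    weighted_laplace mu B Z t = ((al + be * t) `^ (- l))%:E} ->
  (weighted_laplace mu B Z t < +oo)%E ->
  0 < al + be * t /\ weighted_laplace mu B Z t = ((al + be * t) `^ (- l))%:E.
Proof.
move=> mB mZ B0 Z0 l0 be0 ab LE.
pose tau := al / be.
pose Z' w := Z w * expR (tau * B w).
have mZ' : measurable_fun setT Z'.
  apply: measurable_funM => //; apply: measurableT_comp => //.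
  exact: measurable_funM.
have Z'0 w : 0 <= Z' w by rewrite mulr_ge0// expR_ge0.
have affE s : al + be * s = be * (s + tau).
  by rewrite /tau; field; rewrite gt_eqF.
have shift s : weighted_laplace mu B Z s = weighted_laplace mu B Z' (s + tau).
  apply: eq_integral => w _; congr EFin; rewrite /Z' -mulrA -expRD.
  by congr (_ * expR _); ring.
pose u := (a + b) / 2.
have [au ub] : a < u /\ u < b by rewrite !midf_lt.
have ut : 0 < u + tau.
  by have [|] := LE u; rewrite ?in_itv/= ?au// affE pmulr_rgt0.
(* Starting the interval at the midpoint [u] makes its translated left end positive at once. *)
have LE' s : 0 < s -> weighted_laplace mu B Z' s = (be `^ (- l) * s `^ (- l))%:E.
  move=> s0; apply: (@weighted_laplace_gamma _ _ _ _ _ _ _ _ (u + tau) (b + tau)) => //.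
  - exact: ltW.
  - by rewrite ltrD2r.
  - move=> x; rewrite in_itv/= => /andP[ux xb].
    have [|] := LE (x - tau); first by rewrite in_itv/=; lra.
    rewrite shift affE subrK => _ ->; rewrite powRM// ltW//.
    exact: lt_trans ux.
rewrite shift affE => fin.
have t0 : 0 < t + tau.
  by apply: weighted_laplace_gamma_pos LE' fin => //; exact: powR_gt0.
by rewrite LE'// powRM ?(ltW be0) ?(ltW t0)// mulr_gt0.
Qed.

(** Equality would force the nonnegative difference [D] of the integrands to vanish almost
    everywhere, whereas it is positive wherever [B > 0]. *)
Lemma weighted_laplace_decr (d : measure_display) (T : measurableType d)
    (R : realType) (Pr : probability T R) (B Z : T -> R) (s t : R) :
  measurable_fun setT B -> measurable_fun setT Z ->
  (forall w, 0 <= B w) -> (forall w, 0 < Z w) ->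
  Pr [set w | 0 < B w] = 1%E -> s < t ->
  (weighted_laplace Pr B Z s < +oo)%E ->
  (weighted_laplace Pr B Z t < weighted_laplace Pr B Z s)%E.
Proof.
move=> mB mZ B0 Z0 B1 st fin.
have Z0' w : 0 <= Z w by exact: ltW.
rewrite lt_neqAle (weighted_laplace_nincr Pr mB mZ B0 Z0' (ltW st)) andbT.
apply/eqP => E.
pose D w := Z w * (expR (- (s * B w)) - expR (- (t * B w))).
have D0 w : 0 <= D w.
  by rewrite mulr_ge0// subr_ge0 ler_expR lerN2 ler_wpM2r// ltW.
have mexp u : measurable_fun setT (fun w => expR (- (u * B w))).
  apply: measurableT_comp => //; apply: measurableT_comp => //.
  exact: measurable_funM.
have mD : measurable_fun setT D.
  by apply: measurable_funM => //; exact: measurable_funB.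
have sE : weighted_laplace Pr B Z s =
    (weighted_laplace Pr B Z t + \int[Pr]_w (D w)%:E)%E.
  rewrite -ge0_integralD//.
  - by apply: eq_integral => w _; rewrite -EFinD /D; congr EFin; ring.
  - by move=> w _; rewrite lee_fin mulr_ge0// expR_ge0.
  - exact: measurable_weighted_exp.
  - by move=> w _; rewrite lee_fin.
  - exact/measurable_EFinP.
have W0 : (0 <= weighted_laplace Pr B Z s)%E.
  by apply: integral_ge0 => w _; rewrite lee_fin mulr_ge0// expR_ge0.
have ID : (\int[Pr]_w `|(D w)%:E|)%E = 0%E.
  under eq_integral => w _ do rewrite gee0_abs ?lee_fin//.
  have Wfin : weighted_laplace Pr B Z s \is a fin_num by rewrite ge0_fin_numE.
  rewrite E in sE; rewrite -[LHS](addeK _ Wfin).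
  by rewrite [X in (X - _)%E]addeC -sE subee.
have mDE : measurable_fun setT (EFin \o D) by exact/measurable_EFinP.
have [N [mN N0 DN]] := (ae_eq_integral_abs Pr measurableT mDE).1 ID.
have : (Pr [set w | 0 < B w]%R <= Pr N)%E.
  apply: le_measure; rewrite ?inE//.
    have -> : [set w | 0 < B w] = setT `&` B @^-1` `]0, +oo[.
      by rewrite setTI; apply/seteqP; split=> w /=; rewrite in_itv/= andbT.
    exact: mB.
  move=> w /= Bw; apply: DN => /(_ Logic.I) /= [] /eqP.
  apply/negP; rewrite gt_eqF// mulr_gt0// subr_gt0 ltr_expR ltrN2.
  by rewrite ltr_pM2r.
by rewrite B1 [Pr N]N0 lee_fin ler10.
Qed.

(** * Affine polynomials *)

Lemma poly_atE (R : realType) (n : nat) (P : mpoly n R) (theta : 'rV[R]_n) :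
  poly_at P theta =
  \sum_(m <- msupp P) mcoeff m P * \prod_(i < n) theta 0 i ^+ m i.
Proof. exact: mevalE. Qed.

(** If [m i >= 2], the coefficient of [m] in [P] reappears in the second derivative, multiplied by
    nonzero integers. *)
Lemma affine_poly_msupp (R : realType) (n : nat) (P : mpoly n R)
    (m : multinom n) (i : 'I_n) :
  affine_poly P -> m \in msupp P -> (m i <= 1)%N.
Proof.
move=> affP; rewrite mcoeff_msupp; apply: contraR; rewrite -ltnNge => mi.
pose m' := mnm_sub (mnm_sub m (mnm1 i)) (mnm1 i).
have em : m = mnm_add (mnm_add m' (mnm1 i)) (mnm1 i).
  apply/mnmP => j; rewrite !(mnmDE, mnmBE) mnm1E.
  by case: eqVneq => [<-|_] /=; lia.
have := congr1 (mcoeff m') (affP i); rewrite mcoeff0 !mcoeff_deriv.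
by rewrite -em => /eqP; rewrite !mulrn_eq0.
Qed.

Lemma sum_mcoeff_eq (R : realType) (n : nat) (P : mpoly n R) k :
  \sum_(m <- msupp P) mcoeff m P * (m == k)%:R = mcoeff k P.
Proof.
rewrite [in RHS](mpolyE P) raddf_sum/=; apply: eq_bigr => m _.
by rewrite mcoeffZ mcoeffX.
Qed.

Definition set_coord (R : realType) (n : nat) (theta : 'rV[R]_n) (i : 'I_n)
    (t : R) : 'rV[R]_n :=
  \row_j (if j == i then t else theta 0 j).

Lemma poly_at_set_coord (R : realType) (n : nat) (P : mpoly n R)
    (theta : 'rV[R]_n) (i : 'I_n) (t : R) : affine_poly P ->
  poly_at P (set_coord theta i t) = poly_at P (set_coord theta i 0) +
    (poly_at P (set_coord theta i 1) - poly_at P (set_coord theta i 0)) * t.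
Proof.
move=> affP; rewrite !poly_atE -sumrB mulr_suml -big_split/=.
rewrite [LHS]big_seq [RHS]big_seq; apply: eq_bigr => m mP.
have E s : \prod_(j < n) set_coord theta i s 0 j ^+ m j =
    s ^+ m i *
    \prod_(j < n | j != i) theta 0 j ^+ m j.
  rewrite (bigD1 i)//= mxE eqxx; congr (_ * _).
  by apply: eq_bigr => j ji; rewrite mxE (negbTE ji).
rewrite !E; have := affine_poly_msupp i affP mP.
by case: (m i) => [|[|//]] _; rewrite ?expr0 ?expr1; ring.
Qed.

Lemma poly_at_axis (R : realType) (n : nat) (P : mpoly n R) (i : 'I_n) (t : R) :
  affine_poly P ->
  poly_at P (set_coord 0 i t) = poly_at P 0 + lin_coef P i * t.
Proof.
move=> affP; rewrite poly_at_set_coord//.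
have -> : set_coord (0 : 'rV[R]_n) i 0 = 0.
  by apply/rowP => j; rewrite !mxE if_same.
congr (_ + _ * _); rewrite !poly_atE -sumrB /lin_coef -sum_mcoeff_eq.
rewrite [LHS]big_seq [RHS]big_seq; apply: eq_bigr => m mP.
rewrite -mulrBr; congr (_ * _); rewrite (bigD1 i)//= [X in _ - X](bigD1 i)//=.
rewrite !mxE eqxx expr1n mul1r.
set Q := \prod_(j < n | j != i) _.
have -> : Q = \prod_(j < n | j != i) 0 ^+ m j.
  by apply: eq_bigr => j ji; rewrite mxE (negbTE ji) mxE.
under [X in _ - _ * X]eq_bigr do rewrite mxE.
have := affine_poly_msupp i affP mP.
case mi: (m i) => [|[|//]] _.
  rewrite expr0 mul1r subrr; case: eqP => // em.
  by move: mi; rewrite em mnm1E eqxx.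
rewrite expr1 mul0r subr0; case: eqVneq => [->|mU].
  by rewrite big1// => j ji; rewrite mnm1E eq_sym (negbTE ji) expr0.
(* A monomial divisible by [theta_i] but different from it contains another variable, which is 0 on
   the axis. *)
have [j /andP[ji mj]] : exists j, (j != i) && (m j != 0%N).
  apply/existsP; apply: contraR mU; rewrite negb_exists => /forallP H.
  apply/eqP/mnmP => j; rewrite mnm1E; have := H j; rewrite (eq_sym j).
  case: (eqVneq i j) => [<-|_]; first by rewrite mi.
  by rewrite /= negbK => /eqP.
by rewrite (bigD1 j)//= expr0n (negbTE mj) mul0r.
Qed.

(** For each monomial of [P], both sides factor over the coordinates: the sum over [S] is the
    expansion of a product of binomials. *)
Lemma gamma_copula_base_poly (R : realType) (n : nat) (P : mpoly n R)
    (w : 'I_n -> R) : affine_poly P ->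
  (forall i, 0 < w i) -> (forall i, lin_coef P i != 0) ->
  (\prod_(i < n) w i) *
    poly_at P (\row_i (((w i)^-1 - 1) / lin_coef P i)) =
  \sum_(S : {set 'I_n}) (-1) ^+ #|S| * poly_at P (- inv_lin_on P S)
     * \prod_(t in S) (1 - w t).
Proof.
move=> affP w0 p0.
under [RHS]eq_bigr => S _ do rewrite poly_atE mulr_sumr mulr_suml.
rewrite exchange_big/= poly_atE mulr_sumr [LHS]big_seq [RHS]big_seq.
apply: eq_bigr => m mP.
rewrite mulrCA -big_split/=.
(* [F i] is the factor of a coordinate in [S] and [G i] that of one outside; [0 ^+ 0] is 1, so [G i]
   is 1 when the monomial omits [theta_i]. *)
pose F i := - (1 - w i) * (- (lin_coef P i)^-1) ^+ m i.
pose G i := 0 ^+ m i : R.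
transitivity (mcoeff m P * \prod_(i < n) (F i + G i)).
  congr (_ * _); apply: eq_bigr => i _; rewrite mxE /F /G.
  have := affine_poly_msupp i affP mP.
  case: (m i) => [|[|//]] _; rewrite ?expr0 ?expr1; first by ring.
  by field; rewrite p0 gt_eqF.
rewrite bigA_distr mulr_sumr; apply: eq_bigr => S _.
rewrite mulrAC -prodrN mulrCA; congr (_ * _).
rewrite [X in X * _]big_mkcond -big_split/=; apply: eq_bigr => i _.
by rewrite !mxE /F /G; case: ifP => _; rewrite ?oppr0 ?mul1r.
Qed.

(** The empty set contributes [P(0) = 1], and a singleton contributes 0 because
    [P(-e_i / p_i) = 1 - 1]. *)
Lemma gamma_copula_baseE (R : realType) (n : nat) (P : mpoly n R) (l : R)
    (v : 'rV[R]_n) :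
  affine_poly P -> poly_at P 0 = 1 -> (forall i, lin_coef P i != 0) ->
  gamma_copula_base P l v =
  \sum_(S : {set 'I_n}) (-1) ^+ #|S| * poly_at P (- inv_lin_on P S)
     * \prod_(t in S) (1 - v 0 t `^ l^-1).
Proof.
move=> affP P0 p0; rewrite /gamma_copula_base.
rewrite [RHS](bigID (fun S : {set 'I_n} => (1 < #|S|)%N))/= [RHS]addrC.
congr (_ + _); rewrite (bigD1 finset.set0) ?cards0//= big_set0 mul1r mulr1.
have -> : - inv_lin_on P finset.set0 = 0 by apply/rowP => j; rewrite !mxE inE oppr0.
rewrite P0 big1 ?addr0// => S /andP[S1 S0].
have /cards1P[i ->] : #|S| == 1%N.
  by rewrite eqn_leq leqNgt S1 card_gt0.
have -> : - inv_lin_on P (finset.set1 i) = set_coord 0 i (- (lin_coef P i)^-1).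
  by apply/rowP => j; rewrite !mxE inE; case: eqP => [->|_]; rewrite ?oppr0.
by rewrite poly_at_axis// P0 mulrN mulfV// subrr mulr0 mul0r.
Qed.

Lemma set_coord_id (R : realType) (n : nat) (theta : 'rV[R]_n) (i : 'I_n) :
  set_coord theta i (theta 0 i) = theta.
Proof. by apply/rowP => j; rewrite mxE; case: eqP => [->|]. Qed.

(** * Propagation over the nonnegative orthant *)

Lemma on_positive_orthant_ae (d : measure_display) (T : measurableType d)
    (R : realType) (n : nat) (Pr : probability T R) (X : 'I_n -> {RV Pr >-> R}) :
  on_positive_orthant X -> {ae Pr, forall w, forall i, 0 < X i w}.
Proof.
move=> Xpos; pose A := \bigcap_(i in [set: 'I_n]) (X i @^-1` `]0, +oo[).
have AE : [set w | forall i, 0 < X i w] = A.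
  apply/seteqP; split=> w /= H i; last by have := H i I; rewrite /= in_itv/= andbT.
  by move=> _ /=; rewrite in_itv/= andbT.
have mA : measurable A.
  apply: fin_bigcap_measurable => [|i _]; first exact: finite_finset.
  by rewrite -[X in measurable X]setTI; apply: measurable_funP.
exists (~` A); split; first exact: measurableC.
  by rewrite probability_setC// -AE [Pr _]Xpos subee.
by apply: subsetC; rewrite -AE.
Qed.

Lemma on_positive_orthant_norm (d : measure_display) (T : measurableType d)
    (R : realType) (n : nat) (Pr : probability T R) (X : 'I_n -> {RV Pr >-> R})
    (i : 'I_n) :
  on_positive_orthant X -> Pr [set w | 0 < `|X i w|] = 1%E.
Proof.
move=> Xpos; have mX : measurable [set w | 0 < `|X i w|].
  have -> : [set w | 0 < `|X i w|] = setT `&` (fun w => `|X i w|) @^-1` `]0, +oo[.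
    by rewrite setTI; apply/seteqP; split=> w /=; rewrite in_itv/= andbT.
  have mN : measurable_fun setT (fun w => `|X i w|) by exact: measurableT_comp.
  exact: mN.
have [N [mN N0 XN]] := on_positive_orthant_ae Xpos.
rewrite -(probability_setT Pr) -(setUv [set w | 0 < `|X i w|]) measureU//.
- rewrite [X in (_ = _ + X)%E](_ : _ = 0%E) ?adde0//.
  apply/eqP; rewrite eq_le measure_ge0 andbT -N0 le_measure ?inE//.
    exact: measurableC.
  move=> w /= Xw; apply: XN => /(_ i) H; apply: Xw.
  by rewrite normr_gt0 gt_eqF.
- exact: measurableC.
- by rewrite setICr.
Qed.

(* With absolute values the exponent is monotone in theta everywhere, instead
   of almost everywhere. *)
Lemma laplace_norm (d : measure_display) (T : measurableType d)
    (R : realType) (n : nat) (Pr : probability T R) (X : 'I_n -> {RV Pr >-> R})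
    (theta : 'rV[R]_n) :
  on_positive_orthant X ->
  laplace X theta =
  (\int[Pr]_w (expR (- \sum_(j < n) theta 0 j * `|X j w|))%:E)%E.
Proof.
move=> Xpos; rewrite /laplace unlock; apply: ge0_ae_eq_integral => //.
- apply/measurable_EFinP; apply: measurableT_comp => //.
  apply: measurableT_comp => //; apply: measurable_sum => j.
  exact: measurable_funM.
- apply/measurable_EFinP; apply: measurableT_comp => //.
  apply: measurableT_comp => //; apply: measurable_sum => j.
  by apply: measurable_funM => //; exact: measurableT_comp.
- apply: filterS (on_positive_orthant_ae Xpos) => w Xw _.
  congr (expR (- _))%:E; apply: eq_bigr => j _.
  by rewrite gtr0_norm.
Qed.

(** Brings each line parallel to an axis under the one-variable results, with the fixed coordinates
    forming a positive weight. *)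
Lemma laplace_set_coord (d : measure_display) (T : measurableType d)
    (R : realType) (n : nat) (Pr : probability T R) (X : 'I_n -> {RV Pr >-> R})
    (theta : 'rV[R]_n) (i : 'I_n) (t : R) :
  on_positive_orthant X ->
  laplace X (set_coord theta i t) =
  weighted_laplace Pr (fun w => `|X i w|)
    (fun w => expR (- \sum_(j < n | j != i) theta 0 j * `|X j w|)) t.
Proof.
move=> Xpos; rewrite laplace_norm//; apply: eq_integral => w _; congr EFin.
rewrite -expRD -opprD addrC (bigD1 i)//= mxE eqxx.
congr (expR (- (_ + _))).
by apply: eq_bigr => j ji; rewrite mxE (negbTE ji).
Qed.

Lemma laplace_nincr (d : measure_display) (T : measurableType d)
    (R : realType) (n : nat) (Pr : probability T R) (X : 'I_n -> {RV Pr >-> R})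
    (theta theta' : 'rV[R]_n) :
  on_positive_orthant X -> (forall i, theta 0 i <= theta' 0 i) ->
  (laplace X theta' <= laplace X theta)%E.
Proof.
move=> Xpos le_th; rewrite !laplace_norm//.
have mexp (th : 'rV[R]_n) : measurable_fun setT
    (fun w => expR (- \sum_(j < n) th 0 j * `|X j w|)).
  apply: measurableT_comp => //.
  apply: measurableT_comp => //; apply: measurable_sum => j.
  by apply: measurable_funM => //; exact: measurableT_comp.
apply: ge0_le_integral => //.
- exact/measurable_EFinP.
- exact/measurable_EFinP.
- move=> w _; rewrite lee_fin ler_expR lerN2; apply: ler_sum => j _.
  by rewrite ler_wpM2r.
Qed.

Lemma laplace0 (d : measure_display) (T : measurableType d)
    (R : realType) (n : nat) (Pr : probability T R) (X : 'I_n -> {RV Pr >-> R}) :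
  laplace X 0 = 1%E.
Proof.
rewrite /laplace (_ : (fun w => _) = cst 1); first exact: expectation_cst.
apply/funext => w; rewrite big1 ?oppr0 ?expR0// => i _.
by rewrite mxE mul0r.
Qed.

(** Positivity travels with the formula because [weighted_laplace_affine] requires it on the
    starting interval. *)
Definition gamma_at (d : measure_display) (T : measurableType d)
    (R : realType) (n : nat) (Pr : probability T R) (X : 'I_n -> {RV Pr >-> R})
    (P : mpoly n R) (l : R) (theta : 'rV[R]_n) : Prop :=
  0 < poly_at P theta /\ laplace X theta = (poly_at P theta `^ (- l))%:E.

Lemma gamma_at_line (d : measure_display) (T : measurableType d)
    (R : realType) (n : nat) (Pr : probability T R) (X : 'I_n -> {RV Pr >-> R})
    (P : mpoly n R) (l : R) (theta : 'rV[R]_n) (i : 'I_n) (a b t : R) :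
  affine_poly P -> 0 < l -> on_positive_orthant X -> a < b ->
  {in `]a, b[, forall t, gamma_at X P l (set_coord theta i t)} ->
  (laplace X (set_coord theta i t) < +oo)%E ->
  gamma_at X P l (set_coord theta i t).
Proof.
move=> affP l0 Xpos ab; rewrite /gamma_at.
set al := poly_at P (set_coord theta i 0).
set be := poly_at P (set_coord theta i 1) - al.
pose B w := `|X i w|.
pose Z w := expR (- \sum_(j < n | j != i) theta 0 j * `|X j w|).
have mB : measurable_fun setT B by exact: measurableT_comp.
have mZ : measurable_fun setT Z.
  apply: measurableT_comp => //; apply: measurableT_comp => //.
  have -> : (fun w => \sum_(j < n | j != i) theta 0 j * `|X j w|) =
      (fun w => \sum_(j <- enum 'I_n) (j != i)%:R * (theta 0 j * `|X j w|)).
    apply/funext => w; rewrite big_enum/= big_mkcond; apply: eq_bigr => j _.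
    by case: ifP => _; rewrite ?mul1r ?mul0r.
  apply: measurable_sum => j; apply: measurable_funM => //.
  by apply: measurable_funM => //; exact: measurableT_comp.
have B0 w : 0 <= B w by exact: normr_ge0.
have Z0 w : 0 < Z w by exact: expR_gt0.
have PE s : poly_at P (set_coord theta i s) = al + be * s.
  exact: poly_at_set_coord.
have LE s : laplace X (set_coord theta i s) = weighted_laplace Pr B Z s.
  exact: laplace_set_coord.
move=> good; rewrite PE LE.
have {}good : {in `]a, b[, forall s, 0 < al + be * s /\
    weighted_laplace Pr B Z s = ((al + be * s) `^ (- l))%:E}.
  by move=> s /good; rewrite PE LE.
(* The transform strictly decreases between two points of []a, b[] and [l > 0], so the affine
   function strictly increases. *)
have be0 : 0 < be.
  pose s := a + (b - a) / 3; pose u := a + (b - a) / 3 * 2.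
  have /good[s0 Ws] : s \in `]a, b[ by rewrite in_itv/= /s; lra.
  have /good[u0 Wu] : u \in `]a, b[ by rewrite in_itv/= /u; lra.
  have su : s < u by rewrite /s /u; lra.
  have := weighted_laplace_decr mB mZ B0 Z0 (on_positive_orthant_norm i Xpos) su.
  rewrite Ws Wu ltry lte_fin => /(_ isT).
  rewrite !powRN ltf_pV2 ?posrE ?powR_gt0// => H.
  have : al + be * s < al + be * u.
    rewrite ltNge; apply: contraTN H => H; rewrite -leNgt.
    by rewrite ge0_ler_powR ?nnegrE// ltW.
  rewrite ltrD2l; case: (ltrgtP be 0) => // [bn|->]; last by rewrite !mul0r ltxx.
  by rewrite ltr_nM2l// ltNge (ltW su).
by apply: weighted_laplace_affine good => // w; exact: ltW.
Qed.

(** Coordinates pass from [J] to [I] one at a time. Intermediate points mix the two conditions,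
    hence the disjunction in the finiteness hypothesis. *)
Lemma gamma_at_extend (d : measure_display) (T : measurableType d)
    (R : realType) (n : nat) (Pr : probability T R) (X : 'I_n -> {RV Pr >-> R})
    (P : mpoly n R) (l : R) (I J : 'I_n -> R -> Prop) :
  affine_poly P -> 0 < l -> on_positive_orthant X ->
  (forall j, exists a b, a < b /\ {in `]a, b[, forall t, J j t}) ->
  (forall theta : 'rV[R]_n, (forall j, I j (theta 0 j) \/ J j (theta 0 j)) ->
    (laplace X theta < +oo)%E) ->
  (forall theta : 'rV[R]_n, (forall j, J j (theta 0 j)) -> gamma_at X P l theta) ->
  forall theta : 'rV[R]_n, (forall j, I j (theta 0 j)) -> gamma_at X P l theta.
Proof.
move=> affP l0 Xpos Jint fin goodJ.
(* [k] counts the coordinates already moved. *)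
suff H k (theta : 'rV[R]_n) : (k <= n)%N ->
    (forall j : 'I_n, if (j < k)%N then I j (theta 0 j) else J j (theta 0 j)) ->
    gamma_at X P l theta.
  by move=> theta thI; apply: (H n) => // j; rewrite ltn_ord.
elim: k theta => [|k IH] theta kn thIJ; first exact: goodJ.
pose i := Ordinal kn.
have [a [b [ab Jab]]] := Jint i.
rewrite -(set_coord_id theta i).
apply: (gamma_at_line affP l0 Xpos ab).
- move=> t tab; apply: IH; first exact: ltnW.
  move=> j; rewrite mxE; case: eqVneq => [->|ji]; first by rewrite ltnn; exact: Jab.
  have := thIJ j; rewrite ltnS leq_eqVlt.
  by have -> : (j == k :> nat) = false by apply: contra_neqF ji => /eqP jk; apply/val_inj.
- rewrite set_coord_id; apply: fin => j; have := thIJ j.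
  by case: ifP => _ H; [left|right].
Qed.

Lemma gamma_at_orthant (d : measure_display) (T : measurableType d)
    (R : realType) (n : nat) (Pr : probability T R) (X : 'I_n -> {RV Pr >-> R})
    (P : mpoly n R) (l : R) (theta : 'rV[R]_n) :
  affine_poly P -> 0 < l -> on_positive_orthant X -> multivariate_gamma X P l ->
  (forall i, 0 <= theta 0 i) -> gamma_at X P l theta.
Proof.
move=> affP l0 Xpos [D [th0 D0] DE].
have [e e0 box] : exists2 e : R, 0 < e &
    forall th : 'rV[R]_n, (forall j, `|th0 0 j - th 0 j| < e) -> D th.
  have /nbhs_ballP[e /= e0 De] := D0.
  by exists e => // th H; apply: De; split=> // i j; rewrite ord1; exact: H.
(* The coordinatewise minimum with [th0] stays in the box, and its finite transform bounds the one
   at [th]. *)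
have fin0 (th : 'rV[R]_n) : (forall j, th0 0 j - e < th 0 j) ->
    (laplace X th < +oo)%E.
  move=> H; pose th' : 'rV[R]_n := \row_j Num.min (th 0 j) (th0 0 j).
  have le' j : th' 0 j <= th 0 j by rewrite mxE ge_min lexx.
  apply: (le_lt_trans (laplace_nincr Xpos le')).
  have [|_ ->] := DE th'; last by rewrite ltry.
  apply: box => j; rewrite mxE ger0_norm; last by rewrite subr_ge0 ge_min lexx orbT.
  by have := H j; rewrite minEle; case: ifP => _; lra.
(* Upward pass: every coordinate is freed from its upper bound in the box. *)
have good1 (th : 'rV[R]_n) : (forall j, th0 0 j - e < th 0 j) -> gamma_at X P l th.
  apply: (@gamma_at_extend _ _ _ _ _ _ _ _ (fun j t => th0 0 j - e < t)
    (fun j t => `|th0 0 j - t| < e)) => //.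
  - move=> j; exists (th0 0 j - e), (th0 0 j + e); split; first lra.
    by move=> t; rewrite in_itv/= ltr_norml; lra.
  - move=> z H; apply: fin0 => j; case: (H j) => //.
    by rewrite ltr_norml; lra.
  - by move=> z /box; exact: DE.
(* Downward pass: on the nonnegative orthant the transform is at most its value 1 at the origin,
   which gives finiteness. *)
apply: (@gamma_at_extend _ _ _ _ _ _ _ _ (fun j t => 0 <= t)
    (fun j t => 0 <= t /\ th0 0 j - e < t)) => //.
- move=> j; pose m := Num.max 0 (th0 0 j - e).
  exists m, (m + 1); split; first lra.
  move=> t; rewrite in_itv/= {1}/m gt_max => /andP[/andP[t0 et] _].
  by split=> //; exact: ltW.
- move=> z H; apply: (@le_lt_trans _ _ (laplace X 0)).
    by apply: laplace_nincr => // j; rewrite mxE; case: (H j) => // -[].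
  by rewrite laplace0 ltry.
- by move=> z H; apply: good1 => j; case: (H j).
Qed.

(** * Inversion of the marginals and the copula formula *)

Lemma powR_prod (R : realType) (I : finType) (f : I -> R) (r : R) :
  (forall i, 0 <= f i) -> (\prod_i f i) `^ r = \prod_i f i `^ r.
Proof.
move=> f0; suff [] : 0 <= \prod_i f i /\
    (\prod_i f i) `^ r = \prod_i f i `^ r by [].
apply: (big_ind2 (fun x y => 0 <= x /\ x `^ r = y)) => //.
- by rewrite powR1.
- by move=> x1 x2 y1 y2 [x0 <-] [y0 <-]; rewrite mulr_ge0// powRM.
Qed.

Lemma marginal_laplaceE (d : measure_display) (T : measurableType d)
    (R : realType) (n : nat) (Pr : probability T R) (X : 'I_n -> {RV Pr >-> R})
    (i : 'I_n) (t : R) :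
  marginal_laplace X i t = laplace X (set_coord 0 i t).
Proof.
rewrite /marginal_laplace /laplace; congr expectation; apply/funext => w.
rewrite (bigD1 i)//= big1 ?addr0 ?mxE ?eqxx// => j ji.
by rewrite !mxE (negbTE ji) mul0r.
Qed.

(** The [i]-th marginal transform strictly decreases from its value 1 at 0 to [(1 + p_i)^(-l)] at
    1. *)
Lemma lin_coef_gt0 (d : measure_display) (T : measurableType d)
    (R : realType) (n : nat) (Pr : probability T R) (X : 'I_n -> {RV Pr >-> R})
    (P : mpoly n R) (l : R) (i : 'I_n) :
  affine_poly P -> poly_at P 0 = 1 -> 0 < l -> on_positive_orthant X ->
  gamma_at X P l (set_coord 0 i 1) -> 0 < lin_coef P i.
Proof.
move=> affP P0 l0 Xpos [].
rewrite poly_at_axis// P0 mulr1 => p0 LE.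
have c00 : set_coord (0 : 'rV[R]_n) i 0 = 0.
  by apply/rowP => j; rewrite !mxE if_same.
have : (laplace X (set_coord 0 i 1) < laplace X (set_coord 0 i 0))%E.
  rewrite !laplace_set_coord//; apply: weighted_laplace_decr => //.
  - exact: measurableT_comp.
  - rewrite (_ : (fun w => _) = cst 1); first exact: measurable_cst.
    apply/funext => w; rewrite big1 ?oppr0 ?expR0// => j _.
    by rewrite mxE mul0r.
  - by move=> w; exact: expR_gt0.
  - exact: on_positive_orthant_norm.
  - by rewrite -laplace_set_coord// c00 laplace0 ltry.
rewrite c00 laplace0 LE lte_fin; apply: contraTT; rewrite -!leNgt => ple.
have : (1 + lin_coef P i) `^ l <= 1 `^ l.
  by rewrite ge0_ler_powR ?nnegrE ?(ltW p0) ?(ltW l0)//; lra.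
by rewrite powR1 => pl1; rewrite powRN -[leLHS]invr1 lef_pV2 ?posrE ?powR_gt0.
Qed.

Lemma marginal_laplace_invE (d : measure_display) (T : measurableType d)
    (R : realType) (n : nat) (Pr : probability T R) (X : 'I_n -> {RV Pr >-> R})
    (i : 'I_n) (p l u : R) :
  0 < p -> 0 < l ->
  (forall t, 0 <= t -> marginal_laplace X i t = ((1 + p * t) `^ (- l))%:E) ->
  0 < u <= 1 ->
  0 <= ((u `^ l^-1)^-1 - 1) / p /\
  marginal_laplace_inv X i u = ((u `^ l^-1)^-1 - 1) / p.
Proof.
move=> p0 l0 ME /andP[u0 u1]; set t := _ / p.
have w0 : 0 < u `^ l^-1 by exact: powR_gt0.
have t0 : 0 <= t.
  rewrite divr_ge0 ?(ltW p0)// subr_ge0 -[leLHS]invr1 lef_pV2 ?posrE//.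
  have : u `^ l^-1 <= 1 `^ l^-1.
    by rewrite ge0_ler_powR ?nnegrE ?invr_ge0 ?(ltW l0) ?(ltW u0).
  by rewrite powR1.
split=> //; rewrite /marginal_laplace_inv.
have -> : u%:E = marginal_laplace X i t.
  rewrite ME//; congr EFin; rewrite /t mulrCA mulfV ?gt_eqF// mulr1 addrC subrK.
  rewrite -powR_inv1 ?(ltW w0)// -!powRrM mulrNN mul1r mulVf ?gt_eqF//.
  by rewrite powRr1// ltW.
(* The pseudo-inverse recovers [t] because the marginal transform is injective on [[0, +oo[]. *)
apply: pinvKV; rewrite ?inE/= ?in_itv/= ?t0//.
move=> x y; rewrite !inE/= !in_itv/= !andbT => x0 y0.
rewrite !ME// => -[]; rewrite !powRN => /invr_inj /(powR_injective l0).
rewrite !nnegrE !addr_ge0 ?mulr_ge0 ?(ltW p0)// => /(_ isT isT) /addrI.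
by apply: mulfI; rewrite gt_eqF.
Qed.

Unset Implicit Arguments.

Theorem theorem15 (R : realType) (n : nat) (P : mpoly n R) (lambda : R)
    (d : measure_display) (T : measurableType d) (Pr : probability T R)
    (X : 'I_n -> {RV Pr >-> R}) :
  affine_poly P ->
  poly_at P 0 = 1 ->
  0 < lambda ->
  multivariate_gamma X P lambda ->
  on_positive_orthant X ->
  (forall i : 'I_n, 0 < lin_coef P i) /\
  (forall v : 'rV[R]_n, (forall i, 0 < v 0 i <= 1) ->
     0 < gamma_copula_base P lambda v /\
     laplace_copula X v =
       ((\prod_(i < n) v 0 i) * gamma_copula_base P lambda v `^ (- lambda))%:E).
Proof.
move=> affP P0 l0 gammaX Xpos.
have good th := gamma_at_orthant affP l0 Xpos gammaX (theta := th).
have goodc i t : 0 <= t -> gamma_at X P lambda (set_coord 0 i t).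
  by move=> t0; apply: good => j; rewrite !mxE; case: ifP.
have p0 i : 0 < lin_coef P i.
  exact: lin_coef_gt0 affP P0 l0 Xpos (goodc i 1 ler01).
split=> // v v01.
have ME i t : 0 <= t ->
    marginal_laplace X i t = ((1 + lin_coef P i * t) `^ (- lambda))%:E.
  by move=> t0; rewrite marginal_laplaceE (goodc i t t0).2 poly_at_axis// P0.
pose w i := v 0 i `^ lambda^-1.
have w0 i : 0 < w i by apply: powR_gt0; case/andP: (v01 i).
pose th : 'rV[R]_n := \row_i (((w i)^-1 - 1) / lin_coef P i).
have [Pth Lth] : gamma_at X P lambda th.
  apply: good => i; rewrite mxE.
  exact: (marginal_laplace_invE (p0 i) l0 (ME i) (v01 i)).1.
have baseE : gamma_copula_base P lambda v = (\prod_(i < n) w i) * poly_at P th.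
  rewrite gamma_copula_baseE// ?gamma_copula_base_poly//; move=> i;
  by rewrite gt_eqF.
have W0 : 0 < \prod_(i < n) w i by exact: prodr_gt0.
rewrite baseE mulr_gt0//; split=> //.
have -> : laplace_copula X v = laplace X th.
  congr laplace; apply/rowP => i; rewrite !mxE.
  exact: (marginal_laplace_invE (p0 i) l0 (ME i) (v01 i)).2.
rewrite Lth; congr EFin.
rewrite powRM ?(ltW W0) ?(ltW Pth)// mulrA -[LHS]mul1r; congr (_ * _).
have -> : \prod_(i < n) v 0 i = (\prod_(i < n) w i) `^ lambda.
  rewrite powR_prod; last by move=> i; exact: ltW.
  apply: eq_bigr => i _; rewrite /w -powRrM mulVf ?gt_eqF// powRr1//.
  by case/andP: (v01 i) => /ltW.
by rewrite powRN mulfV// gt_eqF// powR_gt0.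
Qed.
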